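(* Let $f(x)=\sum_{k=1}^\infty c_kx^k$ be a hypergeometric function with no constant term. Then $f$ is a simultaneous eigenfunction of the set of all operators $\{U_n\}_{n=1}^\infty$, with respective eigenvalues $\{\lambda_n\}_{n=1}^\infty$ (that is, for every $n\ge1$ there is $\lambda_n\in\mathbb{C}$ with $U_nf=\lambda_nf$), if and only if $$f(x)=C\sum_{k=1}^\infty k^ax^k$$ for some $a\in\mathbb{Z}$ and $C\in\mathbb{C}$.
   Context: For $n\ge1$ the operator $U_n$ acts on formal power series with complex coefficients by $U_n\left(\sum_{k\ge0}c_kx^k\right)=\sum_{k\ge0}c_{nk}x^k$. The ascending factorial is $(c)_k=c(c+1)\cdots(c+k-1)$, $(c)_0=1$. A hypergeometric function is a series $$f(x)=a_0\,x^j\sum_{k=0}^\infty\frac{(a_1)_k\cdots(a_p)_k}{(b_1)_k\cdots(b_q)_k}\frac{x^k}{k!}$$ with integers $j,p,q\ge0$, constant $a_0\in\mathbb{C}\setminus\{0\}$, nonzero complex parameters $a_i,b_i$, no $b_i$ a nonpositive integer. Ratios of consecutive coefficients of the sum are required to be given by a rational function of $k$; in particular these coefficients are all nonzero, i.e. no $a_i$ ($i\ge1$) is a nonpositive integer. *)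

(* Defs.v *)
From mathcomp Require Import all_boot all_order all_algebra.
From mathcomp Require Import reals.
From mathcomp.real_closed Require Import complex.

Set Implicit Arguments.
Unset Strict Implicit.
Unset Printing Implicit Defensive.

Import Order.TTheory GRing.Theory Num.Theory.

Local Open Scope ring_scope.
Local Open Scope complex_scope.

(* A formal power series over C = R[i] is its coefficient sequence:            *)
(* c : fps R stands for \sum_(k >= 0) c k * x^k.                              *)
Definition fps (R : realType) : Type := nat -> R[i].

Definition fps_scale (R : realType) (l : R[i]) (f : fps R) : fps R :=
  fun k => l * f k.

(* Multiplication by x^j. *)
Definition fps_shift (R : realType) (j : nat) (f : fps R) : fps R :=
  fun k => if (j <= k)%N then f (k - j)%N else 0.

Definition U (R : realType) (n : nat) (f : fps R) : fps R :=
  fun k => f (n * k)%N.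

Definition ascfact (R : realType) (c : R[i]) (k : nat) : R[i] :=
  \prod_(i < k) (c + i%:R).

Definition nonpos_integer (R : realType) (c : R[i]) : Prop :=
  exists m : nat, c = - m%:R.

Definition hypergeometric_sum (R : realType) (a b : seq R[i]) : fps R :=
  fun k => (\prod_(c <- a) ascfact c k) / (\prod_(c <- b) ascfact c k)
           / (k`!)%:R.

(* "Not a nonpositive integer" includes "nonzero", so the latter is not       *)
(* required separately. The number p (resp. q) of upper (resp. lower)         *)
(* parameters is size a (resp. size b).                                       *)
Definition hypergeometric (R : realType) (f : fps R) : Prop :=
  exists (j : nat) (a0 : R[i]) (a b : seq R[i]),
    [/\ a0 != 0,
        forall c, c \in a -> ~ nonpos_integer c,
        forall c, c \in b -> ~ nonpos_integer c
      & f =1 fps_scale a0 (fps_shift j (hypergeometric_sum a b))].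

Definition simultaneous_eigenfunction (R : realType) (f : fps R) : Prop :=
  forall n : nat, (1 <= n)%N ->
    exists lambda : R[i], U n f =1 fps_scale lambda f.

(* \sum_(k >= 1) k^a x^k *)
Definition power_series (R : realType) (a : int) : fps R :=
  fun k => if (1 <= k)%N then (k%:R : R[i]) ^ a else 0.

(* Main.v *)
Require Import Defs.
From mathcomp Require Import all_boot all_order all_algebra.
From mathcomp Require Import reals.
From mathcomp.real_closed Require Import complex.
From mathcomp Require Import ring lra zify.

(** Only [U_2] carries information, apart from the exponent of the leading
    monomial.  Since [f 0 = 0], the series starts at some [x^j] with [j >= 1].
    If [j >= 2], then [f 1 = 0], and the eigenvalue equation for [U_j] at
    [k = 1] gives the contradiction [f j = 0].  So [j = 1] and
    [f k] is nonzero for all [k >= 1].  The ratio [f (k+1) / f k] is then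
    [P k / Q k] with [P], [Q] monic products of linear factors
    ([hypergeometric_sum_ratio]), and [f (2k) = l * f k] forces
      [P(2x) P(2x+1) Q(x) = Q(2x) Q(2x+1) P(x)].

    Let [D z] be the order of vanishing of [P / Q] at [z], an integer which is
    zero outside a finite set.  The identity says
      [D z = D (2z) + D (2z+1)],
    hence [D z] is the sum of [D (2^m z + k)] over [k < 2^m], for every [m]
    ([doubling_iter]).  If [z] lies off the real segment [-1, 0], all the points
    [2^m z + k] leave every bounded set as [m] grows, so [D z = 0].  If [z] is
    in the open segment, then [D (z/2) = D z + D (z+1) = D z], so [D] takes the
    value [D z] at all of the points [z / 2^m], and again [D z = 0].  What is
    left is [D (-1)] and [D 0], whose sum is [D (-1/2) = 0]
    ([divisor_classification]).  So [P x / Q x = ((x + 1) / x) ^ a] with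
    [a = D (-1)], and the product of these ratios telescopes to
    [f k = f 1 * k ^ a] ([power_of_ratio]). *)

Set Implicit Arguments.
Unset Strict Implicit.
Unset Printing Implicit Defensive.

Import Order.TTheory GRing.Theory Num.Theory.

Local Open Scope ring_scope.
Local Open Scope complex_scope.

(** * Finitely supported functions with D z = D (2z) + D (2z+1) *)

Lemma doubling_iter (A : pzRingType) (V : nmodType) (D : A -> V) :
  (forall z, D z = D (z *+ 2) + D (z *+ 2 + 1)) ->
  forall m z, D z = \sum_(k < 2 ^ m) D (z *+ 2 ^ m + k%:R).
Proof.
move=> Ddbl; elim=> [|m IHm] z.
  by rewrite expn0 big_ord_recl big_ord0 mulr1n !addr0.
rewrite Ddbl expnS mul2n -addnn big_split_ord (IHm (z *+ 2)) (IHm (_ + 1)).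
congr (_ + _); apply: eq_bigr => k _ /=.
  by rewrite -mulrnA mul2n addnn.
by rewrite mulrnDl -mulrnA mul2n addnn natrD addrA.
Qed.

Lemma seq_norm_bound (R : realDomainType) (T : eqType) (phi : T -> R)
    (s : seq T) :
  exists M, forall c, c \in s -> `|phi c| <= M.
Proof.
elim: s => [|c s [M IHs]]; first by exists 0.
exists (`|phi c| + `|M|) => d; rewrite inE => /predU1P[->|/IHs le_dM].
  by rewrite lerDl.
by rewrite (le_trans le_dM) // (le_trans (ler_norm M)) // lerDr.
Qed.

Lemma ReD (R : rcfType) (x y : R[i]) :
  complex.Re (x + y) = complex.Re x + complex.Re y.
Proof. by case: x; case: y. Qed.

Lemma ImD (R : rcfType) (x y : R[i]) :
  complex.Im (x + y) = complex.Im x + complex.Im y.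
Proof. by case: x; case: y. Qed.

Lemma ReMn (R : rcfType) (x : R[i]) n : complex.Re (x *+ n) = complex.Re x *+ n.
Proof. by elim: n => // n IHn; rewrite !mulrS ReD IHn. Qed.

Lemma ImMn (R : rcfType) (x : R[i]) n : complex.Im (x *+ n) = complex.Im x *+ n.
Proof. by elim: n => // n IHn; rewrite !mulrS ImD IHn. Qed.

(** The function [phi] is a real coordinate that witnesses the escape: once
    [e *+ 2 ^ m] exceeds a bound of [phi] on the support of [D], all terms of
    [doubling_iter] vanish. *)
Lemma doubling_escape (R : archiRealFieldType) (A : nzRingType) (V : nmodType)
    (D : A -> V) (S : seq A) (phi : A -> R) (e : R) (z : A) :
  (forall c, D c != 0 -> c \in S) ->
  (forall c, D c = D (c *+ 2) + D (c *+ 2 + 1)) ->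
  0 < e ->
  (forall m k, (k < 2 ^ m)%N -> e *+ 2 ^ m <= `|phi (z *+ 2 ^ m + k%:R)|) ->
  D z = 0.
Proof.
move=> DS Ddbl e_gt0 escape; have [M leM] := seq_norm_bound phi S.
pose m := Num.bound (M / e).
have ltM : M < e *+ 2 ^ m.
  by rewrite -mulr_natl -ltr_pdivrMr // natrX upper_nthrootP.
rewrite (doubling_iter Ddbl m); apply: big1 => k _; apply/eqP.
apply/contraTT: ltM => /DS/leM le_kM; rewrite -leNgt.
exact: le_trans (escape m k (ltn_ord k)) le_kM.
Qed.

(** The descendants [2^m z + k], [k < 2^m], escape to infinity: to the right if
    [Re z > 0], to the left if [Re z + 1 < 0] since [k <= 2^m], and
    vertically if [Im z] is nonzero. *)
Lemma divisor_off_segment (R : realType) (V : nmodType) (D : R[i] -> V)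
    (S : seq R[i]) (z : R[i]) :
  (forall c, D c != 0 -> c \in S) ->
  (forall c, D c = D (c *+ 2) + D (c *+ 2 + 1)) ->
  D z != 0 -> complex.Im z = 0 /\ -1 <= complex.Re z <= 0.
Proof.
move=> DS Ddbl Dz.
have Re_le0 : complex.Re z <= 0.
  rewrite leNgt; apply/negP => Rez; case/eqP: Dz.
  apply: (doubling_escape (phi := @complex.Re R) DS Ddbl Rez) => m k _.
  rewrite ReD !ReMn (le_trans _ (ler_norm _)) //= lerDl.
  exact: ler0n.
have Re_geN1 : -1 <= complex.Re z.
  rewrite leNgt; apply/negP => Rez; case/eqP: Dz.
  have e_gt0 : 0 < - complex.Re z - 1 by lra.
  apply: (doubling_escape (phi := @complex.Re R) DS Ddbl e_gt0) => m k lt_k.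
  rewrite ReD !ReMn -normrN (le_trans _ (ler_norm _)) //=.
  rewrite mulrnBl mulNrn opprD lerD2l lerN2 ler_nat.
  exact: ltnW.
split; last by rewrite Re_geN1.
apply/eqP; apply: contraNT Dz => Imz; rewrite -normr_gt0 in Imz; apply/eqP.
apply: (doubling_escape (phi := @complex.Im R) DS Ddbl Imz) => m k _.
by rewrite ImD !ImMn /= mul0rn addr0 normrMn.
Qed.

(** Here the equation is used backwards.  Since [z + 1] has positive real part,
    [D (z / 2) = D z + D (z + 1)] reduces to [D (z / 2) = D z], and [z / 2] is
    again in the strip.  A nonzero value would thus recur at infinitely many
    points. *)
Lemma divisor_open_segment (R : realType) (V : nmodType) (D : R[i] -> V)
    (S : seq R[i]) (z : R[i]) :
  (forall c, D c != 0 -> c \in S) ->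
  (forall c, D c = D (c *+ 2) + D (c *+ 2 + 1)) ->
  -1 < complex.Re z < 0 -> D z = 0.
Proof.
move=> DS Ddbl z_itv.
have n2P m : 2 ^+ m != 0 :> R[i] by rewrite expf_neq0 // pnatr_eq0.
have Dhalf m c : -1 < complex.Re c < 0 -> D (c / 2 ^+ m) = D c.
  elim: m c => [|m IHm] c c_itv; first by rewrite expr0 divr1.
  have half2 : (c / 2) *+ 2 = c by rewrite -mulr_natr divfK ?pnatr_eq0.
  have Re_half : complex.Re (c / 2) *+ 2 = complex.Re c by rewrite -ReMn half2.
  rewrite exprS invfM mulrA IHm; last by lra.
  rewrite Ddbl half2 [X in _ + X](_ : _ = 0) ?addr0 //.
  apply/eqP; apply: contraT => /(divisor_off_segment DS Ddbl)[_].
  rewrite ReD /=; lra.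
have z_neq0 : z != 0 by apply: contraTneq z_itv => ->; rewrite /= ltxx andbF.
apply/eqP; apply: contraT => Dz.
pose orbit := [seq z / 2 ^+ m | m <- iota 0 (size S).+1].
suff: (size orbit <= size S)%N by rewrite size_map size_iota ltnn.
apply: uniq_leq_size => [|_ /mapP[m _ ->]]; last by rewrite DS // Dhalf.
rewrite map_inj_uniq ?iota_uniq // => m n /(mulfI z_neq0)/invr_inj/eqP.
by rewrite -!natrX eqr_nat eqn_exp2l // => /eqP.
Qed.

(** The equation at [-1/2], where [D] vanishes, ties the two remaining values
    together. *)
Lemma divisor_classification (R : realType) (V : nmodType) (D : R[i] -> V)
    (S : seq R[i]) :
  (forall c, D c != 0 -> c \in S) ->
  (forall c, D c = D (c *+ 2) + D (c *+ 2 + 1)) ->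
  D (-1) + D 0 = 0 /\ forall z, z != 0 -> z != -1 -> D z = 0.
Proof.
move=> DS Ddbl; split=> [|z z_neq0 z_neqN1].
  have half2 : (- (1 / 2)) *+ 2 = -1 :> R[i] by field.
  have Re_half : complex.Re (- (1 / 2) : R[i]) *+ 2 = -1 by rewrite -ReMn half2.
  rewrite -[RHS](divisor_open_segment (z := - (1 / 2)) DS Ddbl); last by lra.
  by rewrite [RHS]Ddbl half2 addNr.
apply/eqP; apply: contraT => Dz.
have [Im0 /andP[Re_ge Re_le]] := divisor_off_segment DS Ddbl Dz.
rewrite (divisor_open_segment DS Ddbl) ?eqxx // in Dz.
rewrite !lt_neqAle Re_ge Re_le !andbT.
apply/andP; split.
  by apply: contra z_neqN1 => /eqP Re1;
    rewrite eq_complex Im0 -Re1 /= oppr0 !eqxx.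
by apply: contra z_neq0 => /eqP Re0; rewrite eq_complex Im0 Re0 /= !eqxx.
Qed.

(** * Ratios invariant under doubling *)

Definition root_prod (F : fieldType) (s : seq F) (x : F) : F :=
  \prod_(c <- s) (x - c).

Lemma root_prod_cat (F : fieldType) (s t : seq F) x :
  root_prod (s ++ t) x = root_prod s x * root_prod t x.
Proof. by rewrite /root_prod big_cat. Qed.

Lemma root_prod_nseq (F : fieldType) n (c x : F) :
  root_prod (nseq n c) x = (x - c) ^+ n.
Proof. by rewrite /root_prod big_nseq iter_mulr_1. Qed.

Lemma root_prod_affine (F : numFieldType) (s : seq F) (d x : F) :
  root_prod s (x *+ 2 + d) =
  2 ^+ size s * root_prod [seq (c - d) / 2 | c <- s] x.
Proof.
rewrite /root_prod big_map; elim: s => [|c s IHs].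
  by rewrite !big_nil mulr1.
rewrite !big_cons IHs /= exprS.
by field.
Qed.

(** Two polynomials that agree at all positive integers are equal; the constants
    [u] and [v] then agree because the products are monic. *)
Lemma root_prod_perm (F : numFieldType) (s t : seq F) (u v : F) :
    u != 0 ->
    (forall k, (0 < k)%N -> u * root_prod s k%:R = v * root_prod t k%:R) ->
  perm_eq s t.
Proof.
move=> u_neq0 eq_st.
pose P (r : seq F) := \prod_(c <- r) ('X - c%:P).
have PE r x : (P r).[x] = root_prod r x.
  by rewrite horner_prod; apply: eq_bigr => c _; rewrite hornerXsubC.
have eqP_st : u *: P s = v *: P t.
  apply/eqP; rewrite -subr_eq0; apply/eqP.
  have [p pE] : exists p, p = u *: P s - v *: P t by eexists.
  rewrite -pE;
  apply: (@roots_geq_poly_eq0 _ p [seq k%:R | k <- iota 1 (size p)]).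
  - apply/allP => x /mapP[k]; rewrite mem_iota => /andP[k_gt0 _] ->.
    by rewrite rootE pE !hornerE !PE eq_st // subrr.
  - by rewrite map_inj_uniq ?iota_uniq // => m n /eqP; rewrite eqr_nat => /eqP.
  - by rewrite size_map size_iota.
have uv : u = v.
  by have /(congr1 lead_coef) := eqP_st;
    rewrite !lead_coefZ !lead_coef_prod_XsubC !mulr1.
by apply/prod_XsubC_eq/(scalerI u_neq0); rewrite {2}uv.
Qed.

(** If [s] and [t] list the roots of [P] and [Q], the conclusion says that
    [P x / Q x = x ^ (q - p) * (x + 1) ^ (p - q)].  Padding both sides avoids
    a case distinction on the sign of the exponent: with [p] and [q] the
    multiplicities of [-1] in [s] and [t], both sides contain [-1] exactly
    [p + q] times. *)
Lemma root_prod_self_similar (R : realType) (s t : seq R[i]) :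
    (forall k, (0 < k)%N ->
       root_prod s k.*2%:R * root_prod s k.*2.+1%:R * root_prod t k%:R =
       root_prod t k.*2%:R * root_prod t k.*2.+1%:R * root_prod s k%:R) ->
  exists p q, perm_eq (s ++ nseq p 0 ++ nseq q (-1))
                      (t ++ nseq q 0 ++ nseq p (-1)).
Proof.
move=> eq_st.
(* The roots of [r (2x)] and of [r (2x+1)]. *)
pose halves (r : seq R[i]) :=
  [seq (c - 0) / 2 | c <- r] ++ [seq (c - 1) / 2 | c <- r].
have doubleE r k : root_prod r k.*2%:R * root_prod r k.*2.+1%:R =
    2 ^+ (size r + size r) * root_prod (halves r) (k%:R : R[i]).
  have kk : k.*2%:R = k%:R *+ 2 :> R[i] by rewrite -muln2 mulrnA.
  rewrite -natr1 kk -[X in root_prod r X]addr0 !root_prod_affine root_prod_cat.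
  by rewrite exprD mulrACA.
have halvesE r z : count_mem z (halves r) =
    (count_mem (z *+ 2) r + count_mem (z *+ 2 + 1)%R r)%N.
  have affE (d c : R[i]) : ((c - d) / 2 == z) = (c == z *+ 2 + d).
    rewrite -(can_eq (mulfK (_ : 2 != 0))) ?pnatr_eq0 // divfK ?pnatr_eq0 //.
    by rewrite subr_eq mulr_natr.
  rewrite count_cat !count_map; congr (_ + _)%N; apply: eq_count => c /=.
    by rewrite affE addr0.
  exact: affE.
have perm_st : perm_eq (halves s ++ t) (halves t ++ s).
  apply: (@root_prod_perm _ _ _ (2 ^+ (size s + size s))
                                (2 ^+ (size t + size t))).
    by rewrite expf_neq0 // pnatr_eq0.
  by move=> k k_gt0;
    rewrite (root_prod_cat (halves s)) (root_prod_cat (halves t)) !mulrA -!doubleE eq_st.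
pose D z : int := (count_mem z s)%:Z - (count_mem z t)%:Z.
have DS z : D z != 0 -> z \in s ++ t.
  apply: contraR; rewrite mem_cat negb_or => /andP[zs zt].
  by rewrite /D !(count_memPn _) // subrr.
have Ddbl z : D z = D (z *+ 2) + D (z *+ 2 + 1).
  have /permP/(_ (pred1 z)) := perm_st.
  rewrite (count_cat _ (halves s)) (count_cat _ (halves t)) !halvesE /D.
  by move=> /(congr1 Posz); rewrite !PoszD; lra.
have [D01 D_eq0] := divisor_classification DS Ddbl.
exists (count_mem (-1) s), (count_mem (-1) t).
have N1_neq0 : (-1 == 0 :> R[i]) = false by rewrite oppr_eq0 oner_eq0.
apply/allP => z _ /=; rewrite !count_cat !count_nseq /= ![_ == z]eq_sym.
apply/eqP; move: D01 (D_eq0 z); rewrite /D => D01 Dz0.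
have [z0|z_neq0] := eqVneq z 0.
  move: D01; rewrite z0 [0 == -1]eq_sym N1_neq0.
  move: (count_mem 0 s) (count_mem 0 t) => s0 t0.
  by move: (count_mem (-1) s) (count_mem (-1) t) => s1 t1; lia.
have [->|z_neqN1] := eqVneq z (-1).
  by move: (count_mem (-1) s) (count_mem (-1) t) => s1 t1; lia.
have := Dz0 z_neq0 z_neqN1.
by move: (count_mem z s) (count_mem z t) => sz tz; lia.
Qed.

(** Comparing [f (2k+2) / f (2k)] with [f (k+1) / f k] gives the hypothesis of
    [root_prod_self_similar]. *)
Lemma power_of_ratio (R : realType) (s t : seq R[i]) (f : nat -> R[i]) :
    (forall k, (0 < k)%N -> root_prod t k%:R != 0) ->
    (forall k, (0 < k)%N -> f k != 0) ->
    (forall k, (0 < k)%N ->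
       f k.+1 * root_prod t k%:R = f k * root_prod s k%:R) ->
    (exists l, forall k, (0 < k)%N -> f k.*2 = l * f k) ->
  exists a : int, forall k, (0 < k)%N -> f k = f 1%N * k%:R ^ a.
Proof.
move=> t_neq0 f_neq0 ratio [l f_dbl].
have l_neq0 : l != 0.
  by apply: contra (f_neq0 2 isT) => /eqP l0; rewrite (f_dbl 1%N) // l0 mul0r.
have [k k_gt0|p [q perm_st]] := @root_prod_self_similar _ s t.
  have k2_gt0 : (0 < k.*2)%N by rewrite double_gt0.
  have := ratio k.*2 k2_gt0; have := ratio k.*2.+1 isT.
  have := ratio k k_gt0; rewrite -doubleS !f_dbl //.
  have := f_neq0 k k_gt0; have := f_neq0 k.*2.+1 isT.
  move=> y_neq0 x_neq0 E1 E2 E3.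
  apply: (mulfI y_neq0); apply: (mulfI x_neq0); apply: (mulfI l_neq0).
  transitivity (l * f k * root_prod s k.*2%:R *
      (f k.*2.+1 * root_prod s k.*2.+1%:R) * root_prod t k%:R); first by ring.
  rewrite -E2 -E3.
  transitivity (l * f k.*2.+1 * root_prod t k.*2%:R * root_prod t k.*2.+1%:R *
      (f k.+1 * root_prod t k%:R)); first by ring.
  by rewrite E1; ring.
exists (p%:Z - q%:Z); elim=> [//|[_ _|k IHk _]]; first by rewrite exp1rz mulr1.
have k_neq0 : k.+1%:R != 0 :> R[i] by rewrite pnatr_eq0.
have k1_neq0 : k.+2%:R != 0 :> R[i] by rewrite pnatr_eq0.
have : root_prod (s ++ nseq p 0 ++ nseq q (-1)) k.+1%:R =
       root_prod (t ++ nseq q 0 ++ nseq p (-1)) k.+1%:R :> R[i].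
  exact: perm_big.
rewrite !root_prod_cat !root_prod_nseq subr0 opprK natr1 => ratio_st.
have t0 := t_neq0 k.+1 isT; apply: (mulIf t0); rewrite ratio // IHk //.
rewrite !expfzDr // -!exprnN -!exprnP.
have kq0 : k.+1%:R ^+ q != 0 :> R[i] by rewrite expf_neq0.
have k1q0 : k.+2%:R ^+ q != 0 :> R[i] by rewrite expf_neq0.
apply: (mulIf kq0); apply: (mulIf k1q0).
transitivity (f 1%N * (root_prod s k.+1%:R * (k.+1%:R ^+ p * k.+2%:R ^+ q))).
  by field.
by rewrite ratio_st; field.
Qed.

(** * Hypergeometric coefficients *)

Lemma ascfact_neq0 (R : realType) (c : R[i]) k :
  ~ nonpos_integer c -> ascfact c k != 0.
Proof.
move=> c_ok; apply/prodf_neq0 => i _; rewrite addr_eq0.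
by apply/eqP => ci; apply: c_ok; exists i.
Qed.

(** The index is shifted by one, with roots [1 - c] rather than [- c], because
    the coefficient [k] of the sum is the coefficient [k + 1] of a series
    starting at [x]. *)
Lemma ascfact_prodS (R : realType) (s : seq R[i]) k :
  \prod_(c <- s) ascfact c k.+1 =
  \prod_(c <- s) ascfact c k * root_prod [seq 1 - c | c <- s] k.+1%:R.
Proof.
rewrite /root_prod big_map -big_split; apply: eq_bigr => c _ /=.
by rewrite /ascfact big_ord_recr /= -[k.+1]addn1 natrD; congr (_ * _); ring.
Qed.

Lemma hypergeometric_sum_neq0 (R : realType) (a b : seq R[i]) k :
    (forall c, c \in a -> ~ nonpos_integer c) ->
    (forall c, c \in b -> ~ nonpos_integer c) ->
  hypergeometric_sum a b k != 0.
Proof.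
move=> a_ok b_ok; have fact_neq0 : k`!%:R != 0 :> R[i].
  by rewrite pnatr_eq0 -lt0n fact_gt0.
have prod_neq0 (s : seq R[i]) : (forall c, c \in s -> ~ nonpos_integer c) ->
    \prod_(c <- s) ascfact c k != 0.
  by move=> s_ok; rewrite prodf_seq_neq0; apply/allP => c /s_ok/ascfact_neq0->.
by rewrite /hypergeometric_sum !mulf_neq0 ?invr_neq0 ?prod_neq0.
Qed.

(** The root [0] in the denominator comes from the factorial. *)
Lemma hypergeometric_sum_ratio (R : realType) (a b : seq R[i]) k :
    (forall c, c \in b -> ~ nonpos_integer c) ->
  hypergeometric_sum a b k.+1 * root_prod (0 :: [seq 1 - c | c <- b]) k.+1%:R =
  hypergeometric_sum a b k * root_prod [seq 1 - c | c <- a] k.+1%:R.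
Proof.
move=> b_ok; have b_neq0 (k' : nat) : \prod_(c <- b) ascfact c k' != 0.
  by rewrite prodf_seq_neq0; apply/allP => c /b_ok/ascfact_neq0->.
have fact_neq0 : k`!%:R != 0 :> R[i] by rewrite pnatr_eq0 -lt0n fact_gt0.
have k_neq0 : k.+1%:R != 0 :> R[i] by rewrite pnatr_eq0.
have := b_neq0 k.+1; rewrite ascfact_prodS mulf_eq0 negb_or => /andP[bk0 rk0].
rewrite /hypergeometric_sum !ascfact_prodS factS natrM.
rewrite [root_prod (0 :: _) _]big_cons subr0 -/(root_prod _ _).
by field; rewrite nat1r fact_neq0 bk0 k_neq0 rk0.
Qed.

(** * Simultaneous eigenfunctions *)

Theorem theorem7p1 (R : realType) (f : fps R)
    (f_hyp : hypergeometric f) (f_const : f 0%N = 0) :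
  simultaneous_eigenfunction f <->
  exists (a : int) (C : R[i]), f =1 fps_scale C (power_series R a).
Proof.
split=> [f_eig|[a [C fE]] n n_gt0]; last first.
  exists (n%:R ^ a) => k; rewrite /U /fps_scale !fE /fps_scale /power_series.
  case: k => [|k]; first by rewrite muln0 /= !mulr0.
  by rewrite muln_gt0 n_gt0 /= natrM expfzMl mulrCA.
have [j [a0 [a [b [a0_neq0 a_ok b_ok fE]]]]] := f_hyp.
have h_neq0 k : hypergeometric_sum a b k != 0 by apply: hypergeometric_sum_neq0.
have j1 : j = 1%N.
  case: j fE => [|[//|j]] fE.
    move: f_const; rewrite fE /fps_scale /fps_shift /= => /eqP.
    by rewrite mulf_eq0 (negPf a0_neq0) (negPf (h_neq0 _)).
  have [l /(_ 1%N)] := f_eig j.+2 isT.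
  rewrite /U /fps_scale muln1 !fE /fps_scale /fps_shift leqnn /= !mulr0 => /eqP.
  by rewrite mulf_eq0 (negPf a0_neq0) (negPf (h_neq0 _)).
have fSE k : f k.+1 = a0 * hypergeometric_sum a b k.
  by rewrite fE j1 /fps_scale /fps_shift /= subn1.
have [l f_dbl] := f_eig 2 isT.
have [||||e f_pow] := @power_of_ratio R [seq 1 - c | c <- a]
    (0 :: [seq 1 - c | c <- b]) f.
- case=> // k _; rewrite /root_prod prodf_seq_neq0; apply/allP => c /=.
  rewrite inE subr_eq0 => /predU1P[->|/mapP[d /b_ok d_ok ->]].
    by rewrite pnatr_eq0.
  apply/eqP; rewrite -nat1r => /addrI kd; apply: d_ok; exists k.
  by rewrite kd opprK.
- by case=> // k _; rewrite fSE mulf_neq0.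
- case=> // k _; rewrite !fSE -[LHS]mulrA -[RHS]mulrA.
  by rewrite (hypergeometric_sum_ratio a k b_ok).
- by exists l => k _; rewrite -mul2n; apply: f_dbl.
exists e, (f 1%N) => k; rewrite /fps_scale /power_series.
by case: k => [|k]; rewrite ?f_const ?mulr0 // f_pow.
Qed.
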